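(* Let $G$ be a connected (possibly infinite) graph. Then $(\operatorname{odw}(G)-1)/2\le \operatorname{ad}(G)\le 6\operatorname{odw}(G)+1$.
   Context: $d_G(u,v)$ denotes the length of a shortest $u$–$v$ path in $G$. A tree-decomposition of $G$ is a pair $(T,(B_t:t\in V(T)))$ where $T$ is a (possibly infinite) tree and $B_t\subseteq V(G)$, such that $V(G)=\bigcup_t B_t$; every edge has both ends in some $B_t$; and if $t_2$ lies on the $T$-path between $t_1,t_3$ then $B_{t_1}\cap B_{t_3}\subseteq B_{t_2}$. Its outer diameter is $\sup_t\max_{u,v\in B_t}d_G(u,v)$, and $\operatorname{odw}(G)$ is the minimum outer diameter over all tree-decompositions of $G$ (possibly $\infty$). For a tree $T$ and a map $\phi:V(G)\to V(T)$, the additive distortion of $(T,\phi)$ is $\sup_{u,v\in V(G)}|d_G(u,v)-d_T(\phi(u),\phi(v))|$; $\operatorname{ad}(G)$ is the minimum $k$ such that there is a tree $T$ and a map $\phi:V(G)\to V(T)$ with additive distortion at most $k$ ($\infty$ if none). *)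

(* Defs.v *)
From HB Require Import structures.
From mathcomp Require Import all_boot all_order all_algebra.
From mathcomp Require Import boolp classical_sets reals constructive_ereal ereal.

Set Implicit Arguments.
Unset Strict Implicit.
Unset Printing Implicit Defensive.

Import Order.TTheory GRing.Theory Num.Theory.
Local Open Scope classical_set_scope.
Local Open Scope ring_scope.
Local Open Scope ereal_scope.

(* Simple graphs of arbitrary cardinality. Classically every type carries an
   [eqType] structure and every [Prop]-valued relation is a [rel], so neither
   restricts the class of graphs. *)
Record sgraph := SGraph {
  vert :> eqType;
  adj : rel vert;
  adj_sym : symmetric adj;
  adj_irr : irreflexive adj }.

(* [u :: p] is the vertex sequence of a path from [u] to [v]; its length is
   [size p]. *)
Definition is_gpath (G : sgraph) (u v : G) (p : seq G) : Prop :=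
  [/\ path (@adj G) u p, uniq (u :: p) & last u p = v].

Definition gconnected (G : sgraph) : Prop :=
  (exists u : G, True) /\ forall u v : G, exists p, is_gpath u v p.

(* The bound excludes the [ucycle]s [:: u; v] that merely go back and forth
   along an edge. *)
Definition acyclic (G : sgraph) : Prop :=
  ~ exists c : seq G, ucycle (@adj G) c /\ (3 <= size c)%N.

Definition is_tree (T : sgraph) : Prop := gconnected T /\ acyclic T.

(* The infima below ([gdist], [odw], [ad]) are over sets of values in
   nat U {+oo}, hence are minima, and are +oo if there is no finite
   candidate. *)
Definition gdist (R : realType) (G : sgraph) (u v : G) : \bar R :=
  ereal_inf [set (size p)%:R%:E | p in [set p | is_gpath u v p]].

Definition is_tree_decomposition (G T : sgraph) (B : T -> set G) : Prop :=
  [/\ is_tree T,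
      forall v : G, exists t, B t v,
      forall u v : G, adj u v -> exists t, B t u /\ B t v
    & forall (t1 t2 t3 : T) (p : seq T),
        is_gpath t1 t3 p -> t2 \in t1 :: p -> B t1 `&` B t3 `<=` B t2].

(* An empty bag contributes -oo, i.e. nothing, to the outer supremum. *)
Definition outer_diameter (R : realType) (G T : sgraph) (B : T -> set G) :
    \bar R :=
  ereal_sup [set ereal_sup [set gdist R u v | u in B t & v in B t]
            | t in [set: T]].

Definition odw (R : realType) (G : sgraph) : \bar R :=
  ereal_inf [set x | exists (T : sgraph) (B : T -> set G),
    is_tree_decomposition B /\ x = outer_diameter R B].

Definition additive_distortion (R : realType) (G T : sgraph) (phi : G -> T) :
    \bar R :=
  ereal_sup [set `|gdist R u v - gdist R (phi u) (phi v)|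
            | u in [set: G] & v in [set: G]].

Definition ad (R : realType) (G : sgraph) : \bar R :=
  ereal_inf [set k%:R%:E | k in [set k : nat |
    exists (T : sgraph) (phi : G -> T),
      is_tree T /\ additive_distortion R phi <= k%:R%:E]].

(* Main.v *)
(** Upper bound (in the stronger form [ad <= 3 odw]): layer [G] by the distance
    to a root and, in each layer [i], identify the vertices that can be joined
    inside the layers [>= i].  These clusters form a tree and [G] maps to it
    without increasing distances; conversely, a walk of length [n] between two
    clusters makes ancestors of theirs coincide after [i] and [j] steps with
    [i + j <= n], so distances drop by at most the diameter of a cluster.  If
    all bags of a tree-decomposition have diameter [<= D], a cluster has diameter
    [<= 3 D]: for [x] and [y] in it, the median bag of bags containing [x], [y]
    and the root meets both geodesics to the root and the walk joining [x] to [y]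
    in the higher layers.

    Lower bound: given [phi : G -> T] of distortion [<= k], take as bags the
    preimages under [phi] of the balls of radius [(k + 1) / 2] around the
    midpoints of the edges of [T]. *)
Require Import Defs.
From mathcomp Require Import all_boot all_order all_algebra.
From mathcomp Require Import boolp classical_sets reals constructive_ereal ereal.
From mathcomp Require Import zify lra.

Set Implicit Arguments.
Unset Strict Implicit.
Unset Printing Implicit Defensive.

Import Order.TTheory GRing.Theory Num.Theory.

(** * Walks and distances *)

Section Walks.
Variable G : sgraph.
Implicit Types (u v w : G) (p q : seq G).

Definition walk u v p : bool := path (@adj G) u p && (last u p == v).

Lemma gpath_walk u v p : is_gpath u v p -> walk u v p.
Proof. by case=> up _ upv; rewrite /walk up upv eqxx. Qed.

Lemma walk_nil u : walk u u [::].
Proof. by rewrite /walk /= eqxx. Qed.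

Lemma walk_cons u v w p : walk u v (w :: p) = adj u w && walk w v p.
Proof. by rewrite /walk /= andbA. Qed.

Lemma walk_cat u v w p q : walk u v p -> walk v w q -> walk u w (p ++ q).
Proof.
rewrite /walk cat_path last_cat => /andP[up /eqP->] /andP[vq vqw].
by rewrite up vq vqw.
Qed.

Lemma walk_split u v w p : walk u v p -> w \in u :: p ->
  exists p1 p2, [/\ p = p1 ++ p2, walk u w p1 & walk w v p2].
Proof.
move=> uvp wp; case/splitPl: wp uvp => p1 p2 p1w.
rewrite /walk cat_path last_cat p1w -andbA => /and3P[up1 wp2 wv].
by exists p1, p2; rewrite up1 p1w eqxx wp2.
Qed.

Lemma walk_at u v p i : walk u v p ->
  walk u (last u (take i p)) (take i p) /\ walk (last u (take i p)) v (drop i p).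
Proof.
rewrite -{1}(cat_take_drop i p) /walk cat_path last_cat -andbA.
by case/and3P=> -> -> ->; rewrite eqxx.
Qed.

Lemma walk_rev u v p : walk u v p ->
  exists q, [/\ walk v u q, size q = size p & v :: q =i u :: p].
Proof.
case/andP=> up /eqP <-; exists (rev (belast u p)); split.
- rewrite /walk rev_path (eq_path (e' := @adj G)) ?up /=; last first.
    by move=> x y; rewrite /= adj_sym.
  by case: p {up} => //= x p; rewrite rev_cons last_rcons.
- by rewrite size_rev size_belast.
- by move=> x; rewrite inE mem_rev [in RHS]lastI mem_rcons inE.
Qed.

Lemma walk_shorten u v p : walk u v p ->
  exists q, [/\ is_gpath u v q, size q <= size p & {subset u :: q <= u :: p}].
Proof.
case/andP=> up /eqP; case/shortenP: up => q uq Uq qp upv.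
exists q; split; first by split.
  by apply: uniq_leq_size => //; case/andP: Uq.
move=> x; rewrite !inE => /predU1P[->|/qp xp]; first by rewrite eqxx.
by rewrite xp orbT.
Qed.

Lemma walk_first_hit (A : pred G) u p : path (@adj G) u p -> A (last u p) ->
  exists p1 p2, [/\ p = p1 ++ p2, A (last u p1) & all (predC A) (belast u p1)].
Proof.
elim: p u => [|w p IH] u /= up Ap; first by exists [::], [::].
have [Au|nAu] := boolP (A u); first by exists [::], (w :: p).
case/andP: up => uw /IH /(_ Ap)[p1 [p2 [-> Ap1 nAp1]]].
by exists (w :: p1), p2; rewrite /= nAu.
Qed.

(** Natural-number version of [gdist], over walks instead of simple paths; the default 0 arises only
    for vertices joined by no walk, hence never in a connected graph. *)
Definition dist u v : nat :=
  if pselect (exists n, `[< exists2 p, walk u v p & size p = n >]) is left h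
  then ex_minn h else 0.

Lemma dist_leq_walk u v p : walk u v p -> dist u v <= size p.
Proof.
move=> uvp; rewrite /dist; case: pselect => [h|_//].
by case: ex_minnP => m _; apply; apply/asboolP; exists p.
Qed.

Hypothesis connG : gconnected G.

Lemma dist_walk u v : exists2 p, walk u v p & size p = dist u v.
Proof.
rewrite /dist; case: pselect => [h|].
  by case: ex_minnP => m /asboolP.
have [p /gpath_walk uvp] := connG.2 u v.
by case; exists (size p); apply/asboolP; exists p.
Qed.

Lemma dist_triangle w u v : dist u v <= dist u w + dist w v.
Proof.
have [p uwp <-] := dist_walk u w; have [q wvq <-] := dist_walk w v.
by rewrite -size_cat; apply/dist_leq_walk/(walk_cat uwp).
Qed.

Lemma dist_sym u v : dist u v = dist v u.
Proof.
have le x y : dist x y <= dist y x.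
  have [p yxp <-] := dist_walk y x; have [q [xyq <- _]] := walk_rev yxp.
  exact: dist_leq_walk.
by apply/eqP; rewrite eqn_leq !le.
Qed.

Lemma dist_on_walk u v p w : walk u v p -> w \in u :: p ->
  dist u w + dist w v <= size p.
Proof.
move=> uvp /(walk_split uvp)[p1 [p2 [-> uwp1 wvp2]]].
by rewrite size_cat leq_add ?dist_leq_walk.
Qed.

Lemma dist_uu u : dist u u = 0.
Proof. by apply/eqP; rewrite -leqn0 (dist_leq_walk (walk_nil u)). Qed.

Lemma dist_eq0 u v : dist u v = 0 -> u = v.
Proof.
move=> d0; have [p] := dist_walk u v; rewrite d0 => /andP[_ /eqP upv] /size0nil p0.
by rewrite -upv p0.
Qed.

Lemma dist_adj u v : adj u v -> dist u v <= 1.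
Proof.
by move=> uv; apply: (@dist_leq_walk _ _ [:: v]); rewrite walk_cons uv walk_nil.
Qed.

Lemma gdistE (R : realType) u v : gdist R u v = (dist u v)%:R%:E%R.
Proof.
apply/eqP; rewrite eq_le; apply/andP; split.
  have [p /walk_shorten[q [uvq qp _]] <-] := dist_walk u v.
  apply: (@le_trans _ _ ((size q)%:R%:E)%R); last by rewrite lee_fin ler_nat.
  by apply: ereal_inf_lbound; exists q.
apply: le_ereal_inf_tmp => _ [p /gpath_walk uvp <-].
by rewrite lee_fin ler_nat dist_leq_walk.
Qed.

End Walks.

(** * Paths in trees *)

Section Trees.
Variable T : sgraph.
Hypothesis acycT : acyclic T.
Implicit Types (a b c s u v : T) (p q : seq T).

(** Otherwise [p] shortens to a simple path avoiding [u], which closes up through [u] to a cycle of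
    length at least 3. *)
Lemma acyclic_nbr u a b p : adj u a -> adj u b -> walk a b p ->
  u \notin a :: p -> a = b.
Proof.
move=> ua ub /walk_shorten[q [[aq Uq aqb] _ qp]] up; apply/eqP.
apply: contra_notT acycT => neq_ab; exists (u :: a :: q); split.
  rewrite /ucycle /= rcons_path aq ua /= aqb adj_sym ub /=.
  by move: Uq => /= ->; rewrite andbT; apply: contra up; apply: qp.
by case: q aqb {aq Uq qp} => //= /eqP; rewrite (negPf neq_ab).
Qed.

Lemma gpath_cons u v w p :
  is_gpath u v (w :: p) <-> [/\ adj u w, u \notin w :: p & is_gpath w v p].
Proof.
by split=> [[/= /andP[uw wp] /andP[up Up] wpv]|[uw up [wp Up wpv]]]; split=> //=;
  rewrite ?uw ?wp ?up.
Qed.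

(** The first steps agree by [acyclic_nbr], since the remainders of the two paths together join [a]
    to [b] avoiding [u]. *)
Lemma gpath_uniq u v p q : is_gpath u v p -> is_gpath u v q -> p = q.
Proof.
elim: p u q => [|a p IH] u [|b q] //.
- by case=> _ _ /= -> [_ /= /andP[+ _] bqv]; rewrite -bqv mem_last.
- by case=> [_ /= /andP[+ _] apv [_ _ /= vu]]; rewrite vu -apv mem_last.
move=> /gpath_cons[ua uap avp] /gpath_cons[ub ubq bvq].
have [q' [vbq' _ eqq']] := walk_rev (gpath_walk bvq).
suff eq_ab : a = b by subst b; rewrite (IH _ _ avp bvq).
apply: (acyclic_nbr ua ub (walk_cat (gpath_walk avp) vbq')).
rewrite -cat_cons mem_cat negb_or uap; apply: contra ubq => uq'.
by rewrite -eqq' inE uq' orbT.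
Qed.

Lemma gpath_sub_walk u v p q :
  is_gpath u v p -> walk u v q -> {subset u :: p <= u :: q}.
Proof. by move=> uvp /walk_shorten[q' [/(gpath_uniq uvp) <-]]. Qed.

Definition between s a b := exists2 p, is_gpath a b p & s \in a :: p.

Lemma between_sym s a b : between s a b -> between s b a.
Proof.
case=> p abp sp; have [q [baq _ qp]] := walk_rev (gpath_walk abp).
have [q' [baq' _ q'q]] := walk_shorten baq; exists q' => //.
have [p' [abp' _ p'q']] := walk_rev (gpath_walk baq').
by rewrite -p'q' (gpath_sub_walk abp abp').
Qed.

Lemma between_walk s a b p : between s a b -> walk a b p -> s \in a :: p.
Proof. by case=> q abq sq /(gpath_sub_walk abq); apply. Qed.

Hypothesis connT : gconnected T.

Lemma between_or s a b c : between s a c -> between s a b \/ between s b c.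
Proof.
move=> sac; have [p abp] := connT.2 a b; have [q bcq] := connT.2 b c.
have := between_walk sac (walk_cat (gpath_walk abp) (gpath_walk bcq)).
rewrite -cat_cons mem_cat => /orP[sp|sq]; first by left; exists p.
by right; exists q => //; rewrite inE sq orbT.
Qed.

(** [s] is where the path from [c] to [a] first meets the path from [a] to [b]; the part before [s]
    avoids the latter, so continuing along it to [b] gives a simple path again. *)
Lemma median a b c : exists s, [/\ between s a b, between s c a & between s c b].
Proof.
have [q abq] := connT.2 a b; have [p cap] := connT.2 c a.
have [cp Ucp cpa] := cap.
have [|p1 [p2 [defp]]] := @walk_first_hit _ (mem (a :: q)) c p cp.
  by rewrite cpa /= mem_head.
set s := last c p1 => /= sq nq.
have [q1 [q2 [defq asq1 sbq2]]] := walk_split (gpath_walk abq) sq.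
have csp1 : walk c s p1.
  by move: cp; rewrite /walk defp cat_path => /andP[-> _]; rewrite eqxx.
have [_ Uq _] := abq.
exists s; split; first by exists q.
  by exists p => //; rewrite defp -cat_cons mem_cat /s mem_last.
exists (p1 ++ q2); last by rewrite -cat_cons mem_cat /s mem_last.
have /andP[cp12 /eqP cp12b] := walk_cat csp1 sbq2; split=> //.
rewrite -cat_cons cat_uniq.
move: Ucp; rewrite defp -cat_cons cat_uniq => /andP[-> _] /=.
move: (Uq); rewrite defq -cat_cons cat_uniq => /and3P[_ q1q2 ->]; rewrite andbT.
apply: contra q1q2 => /hasP[x xq2 /= xp1]; apply/hasP; exists x => //=.
move: xp1; rewrite lastI mem_rcons inE => /predU1P[->|/(allP nq)].
  by rewrite -/s; case/andP: asq1 => _ /eqP <-; rewrite mem_last.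
by rewrite /= inE defq mem_cat xq2 !orbT.
Qed.

Lemma tree_dist_between s a x : between s x a -> s = a \/ dist x s < dist x a.
Proof.
move=> sxa; have [p xap sz] := dist_walk connT x a.
have := dist_on_walk xap (between_walk sxa xap); rewrite sz => le.
have [/(dist_eq0 connT)->|] := posnP (dist s a); [by left|by right; lia].
Qed.

(** Edges are directed towards a root [r]: [nxt v] is the vertex after [v] on the path to [r], and
    of two neighbours one lies on the path of the other. *)
Lemma tree_orientation :
  exists nxt : T -> T, forall a b, adj a b -> nxt a = b \/ nxt b = a.
Proof.
have [r _] := connT.1.
have /choice[P Pr] : forall v, exists p, is_gpath v r p by move=> v; apply: connT.2.
exists (fun v => head v (P v)) => a b ab.
have [bPa|bPa] := boolP (b \in a :: P a).
  left; have [p1 [p2 [defP ap1b bp2]]] := walk_split (gpath_walk (Pr a)) bPa.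
  have [p [brp _ sub]] := walk_shorten bp2.
  suff /(gpath_uniq (Pr a))-> : is_gpath a r (b :: p) by [].
  apply/gpath_cons; split=> //; apply/negP => /sub.
  rewrite inE => /predU1P[eq_ab|ap2]; first by rewrite eq_ab adj_irr in ab.
  by have [_ /= + _] := Pr a; rewrite defP mem_cat ap2 orbT.
right; suff /(gpath_uniq (Pr b))-> : is_gpath b r (a :: P a) by [].
by apply/gpath_cons; rewrite adj_sym.
Qed.

End Trees.

(** Induction along the walk: its first edge lies in some bag [B t], and [s] lies between [tx] and
    [t], so that [B s] contains [x], or between [t] and [ty]. *)
Lemma separator (G T : sgraph) (B : T -> set G) (tx ty s : T) (x y : G) p :
  is_tree_decomposition B -> walk x y p -> B tx x -> B ty y ->
  between s tx ty -> exists2 z, z \in x :: p & B s z.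
Proof.
case=> -[connT acycT] _ edge conv; elim: p x tx => [|x1 p IH] x tx.
  case/andP=> _ /eqP /= -> Btx Bty [q tq sq]; exists y; first by rewrite inE.
  by apply: (conv _ _ _ _ tq sq).
rewrite walk_cons => /andP[xx1 x1y] Bx By sxy.
have [t [Btx Btx1]] := edge _ _ xx1.
have [[q tq sq]|sty] := between_or acycT connT t sxy.
  by exists x; [rewrite mem_head | apply: (conv _ _ _ _ tq sq)].
have [z zp Bz] := IH _ _ x1y Btx1 By sty.
by exists z; rewrite // inE zp orbT.
Qed.

(** * From tree maps to tree-decompositions *)

(** Points of one bag have images at distance at most [k + 1], whence [2k + 1] in [G]. The images of
    adjacent vertices are at most [k + 1] apart, so a ball around the midpoint of their path
    contains both. *)
Lemma tree_decomposition_of_tree_map (G T : sgraph) (phi : G -> T) (k : nat) :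
  gconnected G -> is_tree T ->
  (forall u v, dist u v <= dist (phi u) (phi v) + k) ->
  (forall u v, dist (phi u) (phi v) <= dist u v + k) ->
  exists B : T -> set G, is_tree_decomposition B /\
    forall t u v, B t u -> B t v -> dist u v <= k.*2.+1.
Proof.
move=> connG treeT distG distT; have [connT acycT] := treeT.
have [nxt nxtP] := tree_orientation acycT connT.
pose nx t := if adj t (nxt t) then nxt t else t.
(* [nxt t] need not be a neighbour of [t], as at the root; [nx t] is then [t] itself. *)
have nx1 t : dist t (nx t) <= 1.
  by rewrite /nx; case: ifP => [/dist_adj|_]; rewrite ?(dist_uu).
have nxP a b : adj a b -> nx a = b \/ nx b = a.
  move=> ab; rewrite /nx; have [eq|eq] := nxtP _ _ ab; [left|right]; rewrite eq ?ab //.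
  by rewrite adj_sym ab.
(* For even [k], the bag [B t] is the ball of radius [(k + 1) / 2] around the
   midpoint of the edge from [t] to its parent; for odd [k] the second disjunct
   is redundant and [B t] is the ball of radius [(k + 1) / 2] around [t]. *)
pose s1 := uphalf k; pose s2 := k./2.
have s12 : s1 + s2 = k by rewrite /s1 /s2; lia.
have s21 : s2 <= s1 <= s2.+1 by rewrite /s1 /s2; lia.
pose B t : set G := fun v => dist (phi v) t <= s1 \/ dist (phi v) (nx t) <= s2.
have tri := dist_triangle connT; have sym := dist_sym connT.
have Bnear t v : B t v -> dist (phi v) t <= s2.+1.
  move=> [|]; first lia.
  by have := tri (nx t) (phi v) t; rewrite (sym (nx t)); have := nx1 t; lia.
exists B; split; last first.
  move=> t u v Bu Bv; have := distG u v.
  have := tri t (phi u) (phi v); have := tri (nx t) (phi u) (phi v).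
  have := tri (nx t) (phi u) t; have := tri (nx t) (phi v) t.
  have := nx1 t; rewrite -!(sym (phi v)) !(sym (nx t) t).
  by case: Bu; case: Bv; lia.
split=> //.
- by move=> v; exists (phi v); left; rewrite dist_uu.
- move=> u v /dist_adj uv; have := distT u v.
  (* The path is cut after [s1] steps, at [c]; at most [s2 + 1] steps remain. *)
  have [p upv <-] := dist_walk connT (phi u) (phi v) => szp.
  have [a_c c_b] := walk_at s1 upv; set c := last _ _ in a_c c_b.
  have dac : dist (phi u) c <= s1.
    by apply: leq_trans (dist_leq_walk a_c) _; rewrite size_take_min geq_minl.
  have := dist_leq_walk c_b; have := size_drop s1 p.
  case: (drop s1 p) c_b => [|c' r] c_b /= szr dcb.
    by exists c; split; left; rewrite // (sym _ c); lia.
  move: c_b; rewrite walk_cons => /andP[/nxP cc' /dist_leq_walk dc'b].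
  (* The length exceeds [2 s1] only if [k] is even and the length is [k + 1]; the middle edge then
     joins [c] to [c']. *)
  have [small|big] := leqP (size p) s1.*2.
    by exists c; split; left; rewrite // (sym _ c); lia.
  case: cc' => eq; [exists c|exists c']; split.
  + by left.
  + by right; rewrite eq (sym _ c'); lia.
  + by right; rewrite eq; lia.
  + by left; rewrite (sym _ c'); lia.
move=> t1 t2 t3 p tp sp v /= [B1 B2].
have t123 : between t2 t1 t3 by exists p.
(* Being strictly closer to [phi v] than a vertex at distance at most [s2 + 1] means being within
   [s2 <= s1]. *)
have done t : t2 = t \/ dist (phi v) t2 < dist (phi v) t -> B t v -> B t2 v.
  by move=> [->//|lt] /Bnear le; left; lia.
have [b|b] := between_or acycT connT (phi v) t123.
  by apply: (done t1) B1; apply: tree_dist_between => //; apply: between_sym.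
by apply: (done t3) B2; apply: tree_dist_between.
Qed.

(** * Trees given by a parent function *)

Section ParentTree.
Variables (V : eqType) (root : V) (lev : V -> nat) (par : V -> V).
Hypothesis lev0 : forall v, lev v = 0 -> v = root.
Hypothesis lev_par : forall v, 0 < lev v -> lev v = (lev (par v)).+1.

(** The level condition rules out the loop that [par root = root] would give. *)
Definition parent_rel : rel V := fun u v =>
  (lev u == (lev v).+1) && (par u == v) || (lev v == (lev u).+1) && (par v == u).

Lemma parent_rel_sym : symmetric parent_rel.
Proof. by move=> u v; rewrite /parent_rel orbC. Qed.

Lemma parent_rel_irr : irreflexive parent_rel.
Proof. by move=> u; rewrite /parent_rel; apply/negP; lia. Qed.

Definition parent_tree : sgraph := SGraph parent_rel_sym parent_rel_irr.

(** Parents lead to the root. On a cycle, both neighbours of a vertex of maximal level would be its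
    parent, hence equal. *)
Lemma parent_tree_is_tree : is_tree parent_tree.
Proof.
have to_root (v : parent_tree) : exists p, walk v root p.
  have [n] := ubnP (lev v); elim: n v => // n IH v ltn.
  have [/lev0->|v0] := posnP (lev v); first by exists [::]; apply: walk_nil.
  have ev := lev_par v0; have [|p wp] := IH (par v); first lia.
  exists (par v :: p); rewrite walk_cons wp andbT.
  by rewrite /= /parent_rel -ev !eqxx.
split; [split; first by exists root|].
  move=> u v; have [p up] := to_root u; have [q vq] := to_root v.
  have [q' [rq _ _]] := walk_rev vq.
  by have [r [ur _ _]] := walk_shorten (walk_cat up rq); exists r.
case=> c [/andP[cycc Uc] szc].
have /hasP[x xc /allP maxx] : has (fun x => all (fun y => lev y <= lev x) c) c.
  case: c szc {cycc Uc} => // a c _; elim: c a => [|b c IH] a.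
    by rewrite /= leqnn.
  have /hasP[x xbc xmax] := IH b.
  apply/hasP; have [le|lt] := leqP (lev a) (lev x).
    by exists x; rewrite 1?inE ?xbc ?orbT //= le.
  exists a; first exact: mem_head.
  apply/allP => y; rewrite inE => /predU1P[->//|/(allP xmax) le].
  by apply: leq_trans le (ltnW lt).
have [i p defc] := rot_to xc.
have : cycle parent_rel (x :: p) by rewrite -defc rot_cycle.
have Up : uniq (x :: p) by rewrite -defc rot_uniq.
have szp : 3 <= size (x :: p) by rewrite -defc size_rot.
have maxp y : y \in p -> lev y <= lev x.
  by move=> yp; apply: maxx; rewrite -(mem_rot i) defc inE yp orbT.
case: p Up szp maxp {defc} => [|a p] // Up szp maxp.
case/lastP: p Up szp maxp => [|p b] // Up _ maxp.
rewrite /= !rcons_path last_rcons => /and3P[xa _ bx].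
have ap : lev a <= lev x by apply: maxp; rewrite mem_head.
have bp : lev b <= lev x by apply: maxp; rewrite inE mem_rcons mem_head orbT.
have eqa : par x = a by case/orP: xa => /andP[/eqP ? /eqP]; first by []; lia.
have eqb : par x = b by case/orP: bx => /andP[/eqP ? /eqP]; last by []; lia.
by move: Up; rewrite /= mem_rcons -eqa -eqb mem_head /= andbF.
Qed.

(** Induction on the walk: a first step to the parent increases [i]; a first step to a child
    decreases [i], or increases [j] if [i = 0]. *)
Lemma parent_tree_walk (u v : parent_tree) p : walk u v p ->
  exists i j, iter i par u = iter j par v /\ i + j <= size p.
Proof.
elim: p u => [|w p IH] u; first by case/andP=> _ /eqP /= ->; exists 0, 0.
rewrite walk_cons => /andP[uw /IH[i [j [eqij leij]]]].
case/orP: uw => /andP[_ /eqP eqp].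
  by exists i.+1, j; rewrite iterSr eqp eqij; split=> //=; lia.
case: i eqij leij => [|i] eqij leij.
  by exists 0, j.+1; rewrite /= -eqij /= eqp; split=> //; lia.
exists i, j; rewrite -eqij iterSr eqp; split=> //=.
exact: leq_trans (leqnSn _) (leqW leij).
Qed.

End ParentTree.

(** * The layering tree *)

Section Layering.
Variables (G : sgraph) (r : G).
Hypothesis connG : gconnected G.
Implicit Types x y z : G.

Definition same_cluster x y : Prop := dist x r = dist y r /\
  exists2 p, walk x y p & forall z, z \in x :: p -> dist x r <= dist z r.

Lemma same_cluster_refl x : same_cluster x x.
Proof.
split=> //; exists [::]; first exact: walk_nil.
by move=> z; rewrite inE => /eqP->.
Qed.

Lemma same_cluster_sym x y : same_cluster x y -> same_cluster y x.
Proof.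
case=> eqxy [p xyp le]; split=> //; have [q [yxq _ qp]] := walk_rev xyp.
by exists q => // z; rewrite qp -eqxy; apply: le.
Qed.

Lemma same_cluster_trans y x z :
  same_cluster x y -> same_cluster y z -> same_cluster x z.
Proof.
case=> eqxy [p xyp lep] [eqyz [q yzq leq]]; split; first by rewrite eqxy.
exists (p ++ q); first exact: walk_cat yzq.
move=> w; rewrite -cat_cons mem_cat => /orP[/lep//|wq].
by rewrite eqxy; apply: leq; rewrite inE wq orbT.
Qed.

Lemma same_cluster_diameter (T : sgraph) (B : T -> set G) (D : nat) x y :
  is_tree_decomposition B ->
  (forall t u v, B t u -> B t v -> dist u v <= D) ->
  same_cluster x y -> dist x y <= 3 * D.
Proof.
move=> decB diamB [eqxy [p xyp lep]].
have [[connT acycT] cover _ _] := decB.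
have [[tx Bx] [ty By]] := (cover x, cover y); have [tr Br] := cover r.
have [s [sxy srx sry]] := median connT tx ty tr.
have [px xrp szx] := dist_walk connG x r.
have [py yrp szy] := dist_walk connG y r.
have [z zp Bz] := separator decB xyp Bx By sxy.
have [x' x'p Bx'] := separator decB xrp Bx Br (between_sym acycT srx).
have [y' y'p By'] := separator decB yrp By Br (between_sym acycT sry).
(* [z] is at level at least that of [x] and within [D] of [x'], so [x'], lying on
   a geodesic from [x] to the root, is within [D] of [x]; likewise for [y']. *)
have := lep _ zp.
have := dist_on_walk xrp x'p; have := dist_on_walk yrp y'p.
have := dist_triangle connG x' z r; have := dist_triangle connG y' z r.
have := diamB _ _ _ Bz Bx'; have := diamB _ _ _ Bz By'.
(* Each summand of [dist x x' + dist x' y' + dist y' y] is at most [D]. *)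
have := diamB _ _ _ Bx' By'.
have := dist_triangle connG x' x y; have := dist_triangle connG y' x' y.
rewrite szx szy (dist_sym connG y' y); lia.
Qed.

(** [par x] is the second vertex of a geodesic from [x] to [r]. *)
Lemma layering_parent : exists par : G -> G,
  par r = r /\ forall x, 0 < dist x r -> adj x (par x) /\ dist x r = (dist (par x) r).+1.
Proof.
suff /choice[par parP] : forall x, exists y, (dist x r = 0 -> y = r) /\
    (0 < dist x r -> adj x y /\ dist x r = (dist y r).+1).
  by exists par; split=> [|x]; [apply: (parP r).1; rewrite dist_uu | apply: (parP x).2].
move=> x; have [p xrp] := dist_walk connG x r.
case: p xrp => [|y p] xrp /= sz; first by exists r; split=> //; rewrite -sz.
exists y; split=> [|_]; first by rewrite -sz.
move: xrp; rewrite walk_cons => /andP[xy /dist_leq_walk]; split=> //.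
by have := dist_triangle connG y x r; have := dist_adj xy; lia.
Qed.

Lemma layering_tree (Delta : nat) :
  (forall x y, same_cluster x y -> dist x y <= Delta) ->
  exists (T : sgraph) (phi : G -> T), is_tree T /\
    forall u v, dist (phi u) (phi v) <= dist u v /\
                dist u v <= dist (phi u) (phi v) + Delta.
Proof.
move=> diam; have [par [par_r parP]] := layering_parent.
have par1 x : dist x (par x) <= 1.
  have [d0|/parP[/dist_adj//]] := posnP (dist x r).
  by rewrite (dist_eq0 connG d0) par_r dist_uu.
(* The walk from [par x] through [x] and [y] to [par y] never goes below the level of [par x]. *)
have cluster_par x y : same_cluster x y -> same_cluster (par x) (par y).
  case=> eqxy [p xyp lep]; have [x0|x0] := posnP (dist x r).
    have y0 : dist y r = 0 by rewrite -eqxy.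
    by rewrite (dist_eq0 connG x0) (dist_eq0 connG y0); apply: same_cluster_refl.
  have [xpx levx] := parP _ x0; have [|ypy levy] := parP y; first by rewrite -eqxy.
  split; first lia.
  exists (x :: p ++ [:: par y]) => [|z].
    rewrite walk_cons adj_sym xpx; apply: walk_cat xyp _.
    by rewrite walk_cons ypy walk_nil.
  rewrite inE -cat_cons mem_cat mem_seq1.
  by case/or3P=> [/eqP->|/lep|/eqP->]; lia.
(* The quotient by clusters is realised by representatives: [rep] depends only on the set, so
   members of one cluster get the same one. *)
have /choice[rep repP] : forall A : set G, exists x, (exists y, A y) -> A x.
  by move=> A; have [[x Ax]|nA] := pselect (exists x, A x); [exists x | exists r].
pose rp x := rep (same_cluster x).
have rp_cluster x : same_cluster x (rp x).
  by apply: repP; exists x; apply: same_cluster_refl.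
have rp_eq x y : same_cluster x y -> rp x = rp y.
  move=> xy; congr rep; apply/seteqP; split=> z.
    by apply: same_cluster_trans; apply: same_cluster_sym.
  exact: same_cluster_trans.
have rpK x : rp (rp x) == rp x by rewrite -(rp_eq _ _ (rp_cluster x)).
pose V : eqType := {x : G | rp x == x}.
pose phi x : V := exist _ (rp x) (rpK x).
pose parV (c : V) : V := phi (par (val c)).
have phi_eq x y : same_cluster x y -> phi x = phi y.
  by move=> /rp_eq eqxy; apply: val_inj.
have phi_par x : parV (phi x) = phi (par x).
  by apply/phi_eq/cluster_par/same_cluster_sym.
have phi_iter i x : iter i parV (phi x) = phi (iter i par x).
  by elim: i => //= i ->; rewrite phi_par.
have lev_phi x : dist (val (phi x)) r = dist x r by have [-> _] := rp_cluster x.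
have phi_inv x y : phi x = phi y -> same_cluster x y.
  move=> /(congr1 val) /= eqxy; apply: (same_cluster_trans (rp_cluster x)).
  by rewrite eqxy; apply: same_cluster_sym.
have lev0 (c : V) : dist (val c) r = 0 -> c = phi r.
  move=> /(dist_eq0 connG) c_r; apply: val_inj => /=.
  by rewrite -c_r (eqP (valP c)).
have lev_par (c : V) : 0 < dist (val c) r ->
    dist (val c) r = (dist (val (parV c)) r).+1.
  by move=> /parP[_ ->]; rewrite lev_phi.
pose T := parent_tree (fun c : V => dist (val c) r) parV.
have [connT acycT] : is_tree T := parent_tree_is_tree lev0 lev_par.
(* Neighbours on one level share a cluster; otherwise [x] shares one with [par y], by the walk
   through [y]. *)
have phi_adj x y : adj x y -> dist x r <= dist y r ->
    dist (phi x : T) (phi y) <= 1.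
  move=> xy le; have := dist_adj xy; have := dist_triangle connG x y r.
  rewrite (dist_sym connG y x) => tri xy1.
  have [eqxy|neqxy] := eqVneq (dist x r) (dist y r).
    rewrite (_ : phi x = phi y) ?dist_uu //; apply: phi_eq; split=> //.
    exists [:: y]; first by rewrite walk_cons xy walk_nil.
    by move=> z; rewrite !inE => /orP[] /eqP-> //; rewrite eqxy.
  have [|ypy levy] := parP y; first lia.
  have -> : phi x = parV (phi y).
    rewrite phi_par; apply: phi_eq; split; first lia.
    exists [:: y; par y]; first by rewrite !walk_cons xy ypy walk_nil.
    by move=> z; rewrite !inE => /or3P[] /eqP->; lia.
  apply: dist_adj; rewrite /= /parent_rel eqxx andbT -(lev_par (phi y)) ?eqxx ?orbT //.
  by rewrite lev_phi; lia.
exists T, phi; split=> // u v; split.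
  have [p uvp <-] := dist_walk connG u v; elim: p u uvp => [|w p IH] u.
    by case/andP=> _ /eqP /= <-; rewrite dist_uu.
  rewrite walk_cons => /andP[uw /IH le] /=.
  apply: leq_trans (dist_triangle connT (phi w) _ _) _; rewrite -add1n leq_add //.
  have [|/ltnW] := leqP (dist u r) (dist w r); first exact: phi_adj.
  by rewrite (dist_sym connT); apply: phi_adj; rewrite adj_sym.
have [p uvp <-] := dist_walk connT (phi u) (phi v).
(* [i] parent steps from [u] and [j] from [v] end in one cluster, and each moves by at most 1 in
   [G], so [dist u v <= i + Delta + j]. *)
have [i [j [+ le]]] := parent_tree_walk uvp.
rewrite !phi_iter => /phi_inv /diam.
have iter_dist k x : dist x (iter k par x) <= k.
  elim: k => [|k IH] /=; first by rewrite dist_uu.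
  have := dist_triangle connG (iter k par x) x (par (iter k par x)).
  by have := par1 (iter k par x); lia.
have := iter_dist i u; have := iter_dist j v; rewrite (dist_sym connG v).
have := dist_triangle connG (iter i par u) u v.
have := dist_triangle connG (iter j par v) (iter i par u) v.
move: (size p) le; lia.
Qed.

End Layering.

(** * The two inequalities *)

Local Open Scope ring_scope.
Local Open Scope ereal_scope.

Lemma outer_diameter_le (R : realType) (G T : sgraph) (B : T -> set G) (x : \bar R) :
  gconnected G ->
  outer_diameter R B <= x <->
  forall t u v, B t u -> B t v -> (dist u v)%:R%:E <= x.
Proof.
move=> connG; split=> [le t u v Bu Bv|le].
  rewrite -gdistE //; apply: le_trans le.
  apply: (@le_trans _ _ (ereal_sup [set gdist R u v | u in B t & v in B t])).
    by apply: ereal_sup_ubound; exists u => //; exists v.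
  by apply: ereal_sup_ubound; exists t.
apply: ge_ereal_sup => _ [t _ <-]; apply: ge_ereal_sup => _ [u Bu [v Bv <-]].
by rewrite gdistE //; apply: le Bu Bv.
Qed.

Lemma additive_distortion_le (R : realType) (G T : sgraph) (phi : G -> T) (k : nat) :
  gconnected G -> gconnected T ->
  additive_distortion R phi <= k%:R%:E <->
  forall u v, (dist u v <= dist (phi u) (phi v) + k)%N /\
              (dist (phi u) (phi v) <= dist u v + k)%N.
Proof.
move=> connG connT.
have E u v : (`|gdist R u v - gdist R (phi u) (phi v)| <= k%:R%:E) =
    (dist u v <= dist (phi u) (phi v) + k)%N &&
    (dist (phi u) (phi v) <= dist u v + k)%N.
  rewrite !gdistE // -EFinB abse_EFin lee_fin.
  rewrite ler_distl lerBlDr -!natrD !ler_nat.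
  by rewrite andbC.
split=> [le u v|le].
  apply/andP; rewrite -E; apply: le_trans le.
  by apply: ereal_sup_ubound; exists u => //; exists v.
apply: ge_ereal_sup => _ [u _ [v _ <-]].
by rewrite E; apply/andP; apply: le.
Qed.

(** Clears the denominator, for infinite values too; read backwards, it isolates an infimum. *)
Lemma le_sub1_div (R : realType) (x y : \bar R) (n : nat) :
  ((x - 1) / n.+1%:R%:E <= y) = (x <= y * n.+1%:R%:E + 1).
Proof.
by rewrite inver (negPf (lt0r_neq0 (ltr0Sn _ _))) lee_pdivrMr ?ltr0Sn // leeBlDr.
Qed.

Lemma odw_le_ad (R : realType) (G : sgraph) : gconnected G ->
  (odw R G - 1) / 2%:E <= ad R G.
Proof.
move=> connG; apply: le_ereal_inf_tmp => _ [k [T [phi [treeT distort]]] <-].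
move: distort => /(additive_distortion_le _ _ _ connG treeT.1) distk.
have [B [decB diamB]] := tree_decomposition_of_tree_map connG treeT
  (fun u v => (distk u v).1) (fun u v => (distk u v).2).
have : odw R G <= (k.*2.+1)%:R%:E.
  apply: (@le_trans _ _ (outer_diameter R B)).
    by apply: ereal_inf_lbound; exists T, B.
  apply/outer_diameter_le => // t u v Bu Bv.
  by rewrite lee_fin ler_nat; apply: diamB Bu Bv.
rewrite le_sub1_div => /le_trans; apply.
by rewrite lee_fin -natr1 -muln2 natrM.
Qed.

Lemma ad_le_odw (R : realType) (G : sgraph) : gconnected G ->
  ad R G <= 6%:E * odw R G + 1.
Proof.
move=> connG.
(* In the form [(ad - 1) / 6 <= odw] the bound can be checked for one decomposition at a time. *)
rewrite muleC -le_sub1_div; apply: le_ereal_inf_tmp => _ [T [B [decB ->]]].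
have [r _] := connG.1; have [_ cover _ _] := decB; have [t0 rt0] := cover r.
have := (outer_diameter_le B (outer_diameter R B) connG).1 (lexx _).
(* The value [-oo] is excluded by the bag [B t0], which contains [r]. *)
case: (outer_diameter R B) => [d|_|/(_ _ _ _ rt0 rt0)]; [|by rewrite leey|by []].
move=> diamB.
have d0 : (0 <= d)%R.
  by have := diamB _ _ _ rt0 rt0; rewrite lee_fin; apply: le_trans.
(* Distances are integers, so the real bound [d] can be truncated. *)
have diamD t u v : B t u -> B t v -> (dist u v <= Num.truncn d)%N.
  by move=> Bu Bv; rewrite truncn_ge_nat // -lee_fin; apply: diamB Bu Bv.
have [T' [phi [treeT' distphi]]] := layering_tree connG
  (fun x y => @same_cluster_diameter _ r connG _ _ _ x y decB diamD).
have : ad R G <= (3 * Num.truncn d)%:R%:E.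
  apply: ereal_inf_lbound; exists (3 * Num.truncn d)%N => //.
  exists T', phi; split=> //; apply/additive_distortion_le => //.
    exact: treeT'.1.
  by move=> u v; have [? ?] := distphi u v; lia.
rewrite le_sub1_div => /le_trans; apply.
have := truncn_itv d0; rewrite lee_fin natrM => /andP[le _]; lra.
Qed.

Theorem theorem1p6 (R : realType) (G : sgraph) (hG : gconnected G) :
  (odw R G - 1) / 2%:E <= ad R G /\ ad R G <= 6%:E * odw R G + 1.
Proof. by split; [apply: odw_le_ad | apply: ad_le_odw]. Qed.
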